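(* For all $n\ge1$ and all $\vec p,\vec q\in[0,1]^n$, with $\bar p=\frac1n\sum_{i=1}^np_i$ and $\bar q=\frac1n\sum_{i=1}^nq_i$, $$\mathrm{TV}(\mathrm{Ber}(\vec p),\mathrm{Ber}(\vec q))\ge c\,\mathrm{TV}\big(\mathrm{Bin}(n,\bar p),\mathrm{Bin}(n,\bar q)\big),$$ where $c\ge\frac1{48C_{\mathrm{BCV}}}$ is a universal constant (in particular the inequality holds with $c=\frac1{48C_{\mathrm{BCV}}}\approx0.017$).
   Context: $\mathrm{Ber}(\vec r)=\mathrm{Ber}(r_1)\otimes\cdots\otimes\mathrm{Ber}(r_n)$ is the product Bernoulli measure on $\{0,1\}^n$; $\mathrm{Bin}(n,\theta)$ is the binomial distribution; $\mathrm{TV}(P,Q)=\frac12\sum_\omega|P(\omega)-Q(\omega)|$. $\eta_{\mathrm{BCV}}$ is the sharp Baillon–Cominetti–Vaisman constant: the smallest constant such that every finite sum $Z$ of independent Bernoulli random variables with $\mathrm{Var}(Z)>0$ satisfies $\max_k\mathbb P(Z=k)\le\eta_{\mathrm{BCV}}/\sqrt{\mathrm{Var}(Z)}$ ($\eta_{\mathrm{BCV}}\approx0.4688$). $C_{\mathrm{BCV}}=\sqrt{5/4+\eta_{\mathrm{BCV}}^2}\approx1.2124$. *)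

(* Defs.v *)
From mathcomp Require Import all_boot all_order all_algebra.
From mathcomp Require Import classical_sets reals.
Set Implicit Arguments. Unset Strict Implicit. Unset Printing Implicit Defensive.
Import Order.TTheory GRing.Theory Num.Theory.
Local Open Scope ring_scope.
Local Open Scope classical_set_scope.

Section Defs.
Variable R : realType.

Definition berP (n : nat) (r : 'I_n -> R) (w : {ffun 'I_n -> bool}) : R :=
  \prod_(i < n) (if w i then r i else 1 - r i).

Definition tv (T : finType) (P Q : T -> R) : R :=
  2^-1 * \sum_(w : T) `|P w - Q w|.

Definition binP (n : nat) (theta : R) (k : 'I_n.+1) : R :=
  ('C(n, k))%:R * theta ^+ k * (1 - theta) ^+ (n - k).

Definition berSumP (n : nat) (r : 'I_n -> R) (k : nat) : R :=
  \sum_(w : {ffun 'I_n -> bool} | #|[pred i | w i]| == k) berP r w.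

Definition berVar (n : nat) (r : 'I_n -> R) : R :=
  \sum_(i < n) r i * (1 - r i).

(* sharp Baillon–Cominetti–Vaisman constant: the smallest C such that
   max_k P(Z = k) <= C / sqrt(Var Z) for every finite sum Z of independent
   Bernoullis with Var Z > 0 *)
Definition eta_BCV : R :=
  inf [set C : R | forall (n : nat) (r : 'I_n -> R),
         (forall i, 0 <= r i <= 1) -> 0 < berVar r ->
         forall k : nat, berSumP r k <= C / Num.sqrt (berVar r)].

Definition C_BCV : R := Num.sqrt (5 / 4 + eta_BCV ^+ 2).

End Defs.
Arguments binP {R} n theta k.

(* Main.v *)
(* Write D for the l1-distance of p and q, T for the total variation distance of
   the two binomials, a and b for their parameters and u = D / T.  The binomial
   theorem evaluates both the sum of min(a,b)^k min(1-a,1-b)^(n-k) C(n,k) and the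
   chi-square divergence; the former gives T <= n|a - b| <= D, the latter
   T^2 n a (1-a) <= 2 D^2.  So u >= 1, and by Cauchy-Schwarz both Var Ber(p) and
   Var Ber(q) are at most 2 u^2.  From below, the product measures are tested
   against a clipped signed count sum_i s_i w_i, s_i = sign(q_i - p_i).  Moving p
   to q one coordinate at a time, each step gains |q_i - p_i| times the probability
   that the count is in the unclipped window, which Chebyshev's inequality controls
   since all hybrids have variance O(u^2).  With a window of half-width 3u this
   yields TV >= (19/288) T.  The constant eta_BCV enters only through C_BCV >= 1. *)
Require Import Defs.
From mathcomp Require Import all_boot all_order all_algebra.
From mathcomp Require Import classical_sets reals.
From mathcomp Require Import ring lra.
Import Order.TTheory GRing.Theory Num.Theory.
Local Open Scope ring_scope.

(** * Total variation: test functions, overlap and chi-square divergence *)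

Section TotalVariation.
Context {R : realType} {T : finType}.
Implicit Types P Q : T -> R.

Lemma tv_ge0 P Q : 0 <= tv P Q.
Proof. by rewrite mulr_ge0 ?invr_ge0 ?ler0n ?sumr_ge0. Qed.

Lemma tvC P Q : tv P Q = tv Q P.
Proof. by congr (_ * _); apply: eq_bigr => w _; rewrite distrC. Qed.

Lemma tv_test P Q (F : T -> R) (L : R) : (forall w, `|F w| <= L) ->
  \sum_w Q w * F w - \sum_w P w * F w <= 2 * L * tv P Q.
Proof.
move=> FL; rewrite /tv mulrACA mulfV ?pnatr_eq0// mul1r -sumrB mulr_sumr.
apply: ler_sum => w _; rewrite -mulrBl (le_trans (ler_norm _))// normrM distrC mulrC.
by rewrite ler_wpM2r.
Qed.

(** Sum the pointwise identity [|x - y| = x + y - 2 min(x, y)]. *)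
Lemma tv_overlap P Q : \sum_w P w = 1 -> \sum_w Q w = 1 ->
  tv P Q = 1 - \sum_w Num.min (P w) (Q w).
Proof.
move=> P1 Q1; suff: \sum_w `|P w - Q w| =
    \sum_w P w + \sum_w Q w - 2 * \sum_w Num.min (P w) (Q w).
  by rewrite /tv P1 Q1 => ->; field.
rewrite mulr_sumr -big_split -sumrB; apply: eq_bigr => w _ /=.
by case: (leP (P w) (Q w)) => ?; [rewrite ler0_norm|rewrite gtr0_norm]; lra.
Qed.

Lemma tv_chi2 P Q : (forall w, 0 < P w) -> \sum_w P w = 1 -> \sum_w Q w = 1 ->
  4 * tv P Q ^+ 2 <= \sum_w Q w ^+ 2 / P w - 1.
Proof.
move=> P0 P1 Q1; set t := 2 * tv P Q.
have tE : t = \sum_w `|P w - Q w| by rewrite /t/tv; field.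
(* The chi-square divergence minus [t ^+ 2], the defect in Cauchy-Schwarz, is this sum. *)
have : 0 <= \sum_w (`|P w - Q w| - t * P w) ^+ 2 / P w.
  by apply: sumr_ge0 => w _; rewrite divr_ge0 ?sqr_ge0 ?ltW.
rewrite (eq_bigr (fun w => Q w ^+ 2 / P w + P w - 2 * Q w
   - 2 * t * `|P w - Q w| + t ^+ 2 * P w)); last first.
  move=> w _; have := lt0r_neq0 (P0 w); have := real_normK (num_real (P w - Q w)).
  move: (`|P w - Q w|) => x xE Pn.
  have -> : (x - t * P w) ^+ 2 = x ^+ 2 - 2 * t * x * P w + t ^+ 2 * P w ^+ 2 by ring.
  by rewrite xE; field.
rewrite !(big_split, sumrN) /= -!mulr_sumr P1 Q1 -tE /t; nra.
Qed.

End TotalVariation.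

(** * Upper bounds for the distance between two binomial laws *)

Section Binomial.
Context {R : realType}.
Implicit Types (a b x : R) (n : nat).

Lemma sum_binomial n x y :
  \sum_(k < n.+1) 'C(n, k)%:R * x ^+ k * y ^+ (n - k) = (x + y) ^+ n :> R.
Proof.
rewrite addrC exprDn; apply: eq_bigr => k _.
by rewrite -[RHS]mulr_natl -mulrA (mulrC (y ^+ _)).
Qed.

Lemma sum_binP n a : \sum_k binP n a k = 1.
Proof. by rewrite sum_binomial subrKC expr1n. Qed.

Lemma bernoulli_ineq n x : x <= 1 -> 1 - n%:R * x <= (1 - x) ^+ n.
Proof.
move=> x1; elim: n => [|n IH]; first by rewrite mul0r subr0.
rewrite exprS -natr1; have := ler_wpM2l (_ : 0 <= 1 - x) IH.
rewrite subr_ge0 => /(_ x1); apply: le_trans.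
have := mulr_ge0 (ler0n R n) (sqr_ge0 x); lra.
Qed.

Lemma tv_binP_le1 n a b : 0 <= a <= 1 -> 0 <= b <= 1 ->
  tv (binP n a) (binP n b) <= 1.
Proof.
move=> /andP[a0 a1] /andP[b0 b1]; rewrite tv_overlap ?sum_binP// gerBl.
by apply: sumr_ge0 => k _; rewrite le_min !mulr_ge0 ?exprn_ge0 ?subr_ge0.
Qed.

(** Replacing each factor by its minimum bounds the overlap from below. The binomial theorem sums
    these terms to [(1 - |a - b|)^n], and Bernoulli's inequality finishes. *)
Lemma tv_binP_lin n a b : 0 <= a <= 1 -> 0 <= b <= 1 ->
  tv (binP n a) (binP n b) <= n%:R * `|a - b|.
Proof.
move=> /andP[a0 a1] /andP[b0 b1]; rewrite tv_overlap ?sum_binP// lerBlDr -lerBlDl.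
apply: le_trans (_ : (Num.min a b + Num.min (1 - a) (1 - b)) ^+ n <= _).
  have -> : Num.min a b + Num.min (1 - a) (1 - b) = 1 - `|a - b|.
    by case: (leP a b) => ab; case: leP => ?;
      [rewrite ler0_norm|rewrite ler0_norm|rewrite gtr0_norm|rewrite gtr0_norm]; lra.
  apply: bernoulli_ineq; rewrite ler_norml; lra.
rewrite -sum_binomial; apply: ler_sum => k _.
have m0 : 0 <= Num.min a b by rewrite le_min a0.
have m1 : 0 <= Num.min (1 - a) (1 - b) by rewrite le_min !subr_ge0 a1.
by rewrite le_min !ler_pM ?mulr_ge0 ?exprn_ge0 ?ler_wpM2l// lerXn2r
   ?nnegrE ?subr_ge0 ?ge_min ?lexx ?orbT.
Qed.

(** Each term is [C(n,k) (b^2/a)^k ((1-b)^2/(1-a))^(n-k)], so the sum is again a binomial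
    expansion. *)
Lemma chi2_binP n a b : 0 < a < 1 ->
  \sum_k binP n b k ^+ 2 / binP n a k = (1 + (b - a) ^+ 2 / (a * (1 - a))) ^+ n.
Proof.
move=> /andP[a0 a1].
have an : a != 0 by rewrite gt_eqF.
have bn : 1 - a != 0 by rewrite subr_eq0 gt_eqF.
rewrite (_ : 1 + _ = b ^+ 2 / a + (1 - b) ^+ 2 / (1 - a)); last first.
  by field; rewrite bn an.
rewrite -sum_binomial; apply: eq_bigr => k _; rewrite /binP.
have Cn : 'C(n, k)%:R != 0 :> R by rewrite pnatr_eq0 -lt0n bin_gt0 -ltnS.
rewrite !expr_div_n (exprAC b) (exprAC (1 - b)).
by field; rewrite Cn !expf_neq0.
Qed.

Lemma tv_binP_var n a b : 0 <= a <= 1 -> 0 <= b <= 1 ->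
  tv (binP n a) (binP n b) ^+ 2 * (n%:R * (a * (1 - a))) <= 2 * (n%:R * (a - b)) ^+ 2.
Proof.
move=> a01 b01; have T1 := @tv_binP_le1 n _ _ a01 b01.
have T0 := tv_ge0 (binP n a) (binP n b); move: (a01) => /andP[a0 a1].
set v := a * (1 - a).
have v0 : 0 <= v by rewrite mulr_ge0 ?subr_ge0.
set d2 := (n%:R * (a - b)) ^+ 2; set t := tv _ _ in T0 T1 *.
have t2 : t ^+ 2 <= 1 by rewrite expr_le1.
have nv0 : 0 <= n%:R * v by rewrite mulr_ge0.
(* If the variance is at most [2 * d2], then [t <= 1] suffices. Otherwise [n * y <= 1/2], the regime
   in which the chi-square bound is effective. *)
have [big|small] := leP (n%:R * v) (2 * d2).
  by apply: le_trans big; rewrite ler_piMl.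
have d20 : 0 <= d2 by apply: sqr_ge0.
have nv : 0 < n%:R * v by lra.
have [n0 vn] : 0 < n%:R :> R /\ v != 0.
  by split; [rewrite lt0r ler0n andbT|]; apply: contraTneq nv => ->; rewrite ?mul0r ?mulr0 ltxx.
have a01' : 0 < a < 1.
  rewrite !lt_neqAle a0 a1 !andbT; apply/andP; split; apply: contraNneq vn => E.
    by rewrite /v -E mul0r.
  by rewrite /v E subrr mulr0.
move: (a01') => /andP[a0' a1'].
have Pgt0 k : 0 < binP n a k.
  by rewrite !mulr_gt0 ?exprn_gt0 ?subr_gt0// ltr0n bin_gt0 -ltnS.
have := tv_chi2 _ (binP n b) Pgt0 (sum_binP n a) (sum_binP n b).
rewrite chi2_binP// -/t -/v.
set y := _ / v => chi.
have yE : n%:R * y * (n%:R * v) = d2 by rewrite /y /d2; field.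
have y0 : 0 <= y by rewrite divr_ge0 ?sqr_ge0.
have ny : n%:R * y <= 2^-1.
  rewrite -(ler_pM2r nv) yE; lra.
have y1 : y <= 1.
  have : 1 <= n%:R :> R by rewrite ler1n -(ltr0n R).
  nra.
have := bernoulli_ineq n _ y1.
(* This product turns Bernoulli's lower bound for [(1 - y)^n] into the upper bound
   [1 / (1 - n y) <= 2] for [(1 + y)^n]. *)
have Z1 : (1 + y) ^+ n * (1 - y) ^+ n <= 1.
  by rewrite -exprMn exprn_ile1//; nra.
set Z := (1 + y) ^+ n in chi Z1; set Y := (1 - y) ^+ n in Z1 *.
have Z0 : 0 <= Z by rewrite exprn_ge0 ?addr_ge0.
move=> YB; have ZB : Z * (1 - n%:R * y) <= 1 by apply: le_trans Z1; apply: ler_wpM2l.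
have tX : t ^+ 2 <= n%:R * y.
  have ny0 : 0 <= n%:R * y by rewrite mulr_ge0.
  move: (n%:R * y) ny ny0 ZB => x xle x0 ZB.
  have Z2 : Z <= 2 by nra.
  by nra.
have := ler_wpM2r nv0 tX; rewrite yE; lra.
Qed.

End Binomial.

(** * Expectations and second moments under product Bernoulli measures *)

Section ProductBernoulli.
Context {R : realType} {n : nat}.
Implicit Types (r : 'I_n -> R) (w : {ffun 'I_n -> bool}) (k : 'I_n).

Definition berE r (F : {ffun 'I_n -> bool} -> R) : R := \sum_w berP r w * F w.

Definition upd w k b : {ffun 'I_n -> bool} := [ffun i => if i == k then b else w i].

Lemma upd_id w k b : w k = b -> upd w k b = w.
Proof. by move=> wk; apply/ffunP => i; rewrite ffunE; case: eqP => // ->. Qed.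

Lemma updd w k b c : upd (upd w k b) k c = upd w k c.
Proof. by apply/ffunP => i; rewrite !ffunE; case: eqP. Qed.

Lemma updk w k b : upd w k b k = b.
Proof. by rewrite ffunE eqxx. Qed.

Lemma berP_ge0 r w : (forall i, 0 <= r i <= 1) -> 0 <= berP r w.
Proof.
move=> r01; apply: prodr_ge0 => i _.
by have /andP[? ?] := r01 i; case: ifP; rewrite ?subr_ge0.
Qed.

(** Conditioning on all coordinates but [k]: configurations are paired by flipping bit [k], and the
    member with that bit off represents the pair. *)
Lemma berE_cond r k F :
  berE r F = \sum_(w : {ffun 'I_n -> bool} | ~~ w k)
    \prod_(i | i != k) (if w i then r i else 1 - r i) *
    (r k * F (upd w k true) + (1 - r k) * F (upd w k false)).
Proof.
rewrite /berE (bigID (fun w : {ffun 'I_n -> bool} => w k)) /=.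
rewrite (reindex_onto (fun w => upd w k true) (fun w => upd w k false)) /=; last first.
  by move=> w wk; rewrite updd upd_id.
rewrite (eq_bigl (fun w : {ffun 'I_n -> bool} => ~~ w k)); last first.
  move=> w; rewrite updk updd; case wk : (w k) => /=.
    by apply/eqP => /ffunP/(_ k); rewrite updk wk.
  by rewrite upd_id ?eqxx.
rewrite -big_split; apply: eq_bigr => w /negbTE wk /=.
rewrite /berP !(bigD1 k (P := xpredT))//= updk wk (upd_id _ _ _ wk).
rewrite (eq_bigr (fun i => if w i then r i else 1 - r i)); last first.
  by move=> i /negbTE ik; rewrite ffunE ik.
ring.
Qed.

(** The expectation is affine in each parameter, with slope the mean discrete derivative of [F] in
    that coordinate. *)
Lemma berE_diff r r' k F : (forall i, i != k -> r' i = r i) ->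
  berE r' F - berE r F =
  (r' k - r k) * berE r (fun w => F (upd w k true) - F (upd w k false)).
Proof.
move=> rr; rewrite !(berE_cond _ k) -sumrB mulr_sumr; apply: eq_bigr => w _.
rewrite !updd (eq_bigr (fun i => if w i then r i else 1 - r i)); last first.
  by move=> i ik; rewrite rr.
ring.
Qed.

Lemma berE_prod r (g : 'I_n -> bool -> R) :
  berE r (fun w => \prod_i g i (w i)) =
  \prod_i (r i * g i true + (1 - r i) * g i false).
Proof.
rewrite (eq_bigr (fun i => \sum_b (if b then r i else 1 - r i) * g i b)); last first.
  by move=> i _; rewrite big_bool.
by rewrite bigA_distr_bigA; apply: eq_bigr => w _; rewrite -big_split.
Qed.

Lemma eq_berE r F G : F =1 G -> berE r F = berE r G.
Proof. by move=> FG; apply: eq_bigr => w _; rewrite FG. Qed.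

Lemma berED r F G : berE r (fun w => F w + G w) = berE r F + berE r G.
Proof. by rewrite -big_split; apply: eq_bigr => w _; rewrite mulrDr. Qed.

Lemma berEZ r c F : berE r (fun w => c * F w) = c * berE r F.
Proof. by rewrite mulr_sumr; apply: eq_bigr => w _; rewrite mulrCA. Qed.

Lemma berE_sum r (I : finType) (F : I -> {ffun 'I_n -> bool} -> R) :
  berE r (fun w => \sum_i F i w) = \sum_i berE r (F i).
Proof.
by rewrite exchange_big; apply: eq_bigr => w _; rewrite mulr_sumr.
Qed.

Lemma berE_le r F G : (forall i, 0 <= r i <= 1) -> (forall w, F w <= G w) ->
  berE r F <= berE r G.
Proof. by move=> r01 FG; apply: ler_sum => w _; rewrite ler_wpM2l ?berP_ge0. Qed.

Lemma berE1 r : berE r (fun=> 1) = 1.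
Proof.
rewrite -(eq_berE r (fun w => \prod_(i < n) 1)); last by move=> w; rewrite big1.
by rewrite (berE_prod r (fun _ _ => 1)) big1// => i _; ring.
Qed.

Lemma berE_coord r k (g : bool -> R) :
  berE r (fun w => g (w k)) = r k * g true + (1 - r k) * g false.
Proof.
rewrite (eq_berE _ _ (fun w => \prod_i (if i == k then g (w i) else 1))); last first.
  by move=> w; rewrite -big_mkcond big_pred1_eq.
rewrite (berE_prod r (fun i b => if i == k then g b else 1)) (bigD1 k)//= eqxx.
by rewrite big1 ?mulr1// => i /negbTE ->; ring.
Qed.

Lemma berE_coord2 r k l (g h : bool -> R) : k != l ->
  berE r (fun w => g (w k) * h (w l)) =
  (r k * g true + (1 - r k) * g false) * (r l * h true + (1 - r l) * h false).
Proof.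
move=> kl.
rewrite (eq_berE _ _ (fun w => \prod_i ((if i == k then g (w i) else 1) *
                                      (if i == l then h (w i) else 1)))); last first.
  by move=> w; rewrite big_split -!big_mkcond !big_pred1_eq.
rewrite (berE_prod r (fun i b => (if i == k then g b else 1) *
                                 (if i == l then h b else 1))).
have lk : l != k by rewrite eq_sym.
rewrite (bigD1 k)//= (bigD1 l)//= !eqxx (negbTE kl) (negbTE lk).
rewrite big1 => [|i /andP[/negbTE -> /negbTE ->]]; ring.
Qed.

Definition wsum (s : 'I_n -> R) w : R := \sum_i s i * (w i)%:R.

(** Variance plus squared bias. Cross terms vanish by independence, and signs of square 1 leave the
    variance unchanged. *)
Lemma berE_wsum_sqr r s m : (forall i, s i ^+ 2 = 1) ->
  berE r (fun w => (wsum s w - m) ^+ 2) =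
  berVar r + (\sum_i s i * r i - m) ^+ 2.
Proof.
move=> s1; set M := \sum_i _ - m.
pose x i (b : bool) : R := s i * (b%:R - r i).
have x0 i : r i * x i true + (1 - r i) * x i false = 0 by rewrite /x /=; ring.
rewrite (eq_berE _ _ (fun w => \sum_i \sum_j x i (w i) * x j (w j)
          + 2 * M * (\sum_i x i (w i)) + M ^+ 2 * 1)); last first.
  move=> w; have -> : wsum s w - m = \sum_i x i (w i) + M.
    rewrite /M addrA -big_split; congr (_ - _); apply: eq_bigr => i _; rewrite /x /=.
    by rewrite -mulrDr subrK.
  rewrite [X in _ = X + _ + _](eq_bigr (fun i => x i (w i) * \sum_j x j (w j))) => [|i _]; last by rewrite mulr_sumr.
  by rewrite -mulr_suml; ring.
rewrite !berED !berEZ berE1 !berE_sum (eq_bigr _ (fun i _ => berE_coord r i (x i))).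
rewrite [X in _ * X]big1 => [|i _]; last exact: x0.
rewrite mulr0 addr0 mulr1; congr (_ + _); apply: eq_bigr => i _.
rewrite berE_sum (bigD1 i)//= [X in _ + X]big1 ?addr0 => [|j ji].
  rewrite (berE_coord r i (fun b => x i b * x i b)) /x /=.
  have -> : r i * (s i * (1 - r i) * (s i * (1 - r i))) +
   (1 - r i) * (s i * (0 - r i) * (s i * (0 - r i))) = s i ^+ 2 * (r i * (1 - r i)) by ring.
  by rewrite s1 mul1r.
by rewrite (berE_coord2 r i j (x i) (x j)) ?x0 ?mul0r// eq_sym.
Qed.

Lemma wsum_upd s w k b c :
  wsum s (upd w k b) - wsum s (upd w k c) = s k * (b%:R - c%:R).
Proof.
rewrite -sumrB (bigD1 k)//= !updk big1 => [|i /negbTE ik]; first by ring.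
by rewrite !ffunE ik subrr.
Qed.

End ProductBernoulli.

(** * Clipping a real number to a symmetric window *)

Section Clip.
Context {R : realType}.
Implicit Types L l x y z : R.

Definition clip L x : R := Num.max (- L) (Num.min L x).

Lemma clipP L x : 0 <= L ->
  [\/ clip L x = x /\ `|x| <= L, clip L x = L /\ L < x | clip L x = - L /\ x < - L].
Proof.
move=> L0; rewrite ler_norml /clip; case: (leP L x) => ?.
  case: (leP (- L) L) => ?; last lra.
  case: (ltP L x) => ?; first by constructor 2; split.
  by constructor 1; split; lra.
by case: (leP (- L) x) => ?; [constructor 1|constructor 3]; split; lra.
Qed.

Lemma clip_norm L x : 0 <= L -> `|clip L x| <= L.
Proof. by move=> L0; case: (clipP _ x L0) => -[-> ?] //; rewrite ler_norml; lra. Qed.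

(** Chebyshev's inequality in pointwise form. If [|z| <= l], both [x] and [x + 1] lie in the window
    and the increment is 1; otherwise the left side is at most 0 and [clip] is monotone. The margin
    1 in [l + 1] covers the distance from [z]. *)
Lemma clip_incr l x z : 0 < l -> `|z - x| <= 1 -> `|z - (x + 1)| <= 1 ->
  1 - z ^+ 2 / l ^+ 2 <= clip (l + 1) (x + 1) - clip (l + 1) x.
Proof.
move=> l0; rewrite !ler_norml => /andP[? ?] /andP[? ?].
have q0 : 0 <= z ^+ 2 / l ^+ 2 by rewrite divr_ge0 ?sqr_ge0.
have zl : `|z| <= l \/ 1 <= z ^+ 2 / l ^+ 2.
  have [|lz] := leP `|z| l; [by left|right].
  rewrite ler_pdivlMr ?exprn_gt0// mul1r -[z ^+ 2]real_normK ?num_real//.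
  by rewrite lerXn2r ?nnegrE // ltW.
have L0 : 0 <= l + 1 by lra.
case: (clipP _ x L0) (clipP _ (x + 1) L0) zl; rewrite !ler_norml => -[-> ?] [] [-> ?] []; lra.
Qed.

End Clip.

(** * Lower bound for product measures by a clipped signed count *)

Section LowerBound.
Context {R : realType} {n : nat}.
Implicit Types p q r : 'I_n -> R.

Lemma berVar_ge0 r : (forall i, 0 <= r i <= 1) -> 0 <= berVar r.
Proof.
by move=> r01; apply: sumr_ge0 => i _; have /andP[? ?] := r01 i; rewrite mulr_ge0 ?subr_ge0.
Qed.

(** The gap between the two sides is the sum of the squares [(r i - a)^2]. *)
Lemma berVar_le_mean r (a := n%:R^-1 * \sum_i r i) : (0 < n)%N ->
  berVar r <= n%:R * (a * (1 - a)).
Proof.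
move=> n0; have aE : n%:R * a = \sum_i r i by rewrite mulVKf// pnatr_eq0 -lt0n.
have : 0 <= \sum_i (r i - a) ^+ 2 by apply: sumr_ge0 => i _; apply: sqr_ge0.
rewrite (eq_bigr (fun i => r i + a ^+ 2 - 2 * a * r i - r i * (1 - r i))); last first.
  by move=> i _; ring.
rewrite !(big_split, sumrN) /= sumr_const card_ord -mulr_sumr -aE -mulr_natl -/(berVar r).
nra.
Qed.

Definition hybrid p q (k : nat) (i : 'I_n) : R := if (i < k)%N then q i else p i.

Lemma tv_berP_ge p q (l : R) (D := \sum_i `|q i - p i|) : 0 < l ->
  (forall i, 0 <= p i <= 1) -> (forall i, 0 <= q i <= 1) ->
  D * (1 - (berVar p + berVar q + D ^+ 2 / 4) / l ^+ 2) <=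
  2 * (l + 1) * tv (berP p) (berP q).
Proof.
move=> l0 p01 q01; set W := _ + D ^+ 2 / 4.
pose s i : R := if p i <= q i then 1 else -1.
have s1 i : s i ^+ 2 = 1 by rewrite /s; case: ifP; rewrite ?sqrrN expr1n.
have sN i : s i * (q i - p i) = `|q i - p i|.
  rewrite /s; case: (leP (p i) (q i)) => pq; first by rewrite mul1r ger0_norm ?subr_ge0.
  by rewrite mulN1r ltr0_norm ?subr_lt0.
(* The mean of the signed count is [m - D / 2] under [p] and [m + D / 2] under [q]. Centring at the
   midpoint keeps every hybrid mean within [D / 2], whence the term [D ^+ 2 / 4] in [W]. *)
pose m := \sum_i s i * p i + D / 2.
pose F (w : {ffun 'I_n -> bool}) := clip (l + 1) (wsum s w - m).
pose h := hybrid p q.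
have h01 k i : 0 <= h k i <= 1 by rewrite /h /hybrid; case: ifP.
have hV k : berVar (h k) <= berVar p + berVar q.
  rewrite -big_split; apply: ler_sum => i _; rewrite /h /hybrid.
  have /andP[? ?] := p01 i; have /andP[? ?] := q01 i.
  have ? : 0 <= p i * (1 - p i) by rewrite mulr_ge0 ?subr_ge0.
  have ? : 0 <= q i * (1 - q i) by rewrite mulr_ge0 ?subr_ge0.
  by case: ifP => _ /=; rewrite ?lerDl ?lerDr.
have hM k : `|\sum_i s i * h k i - m| <= D / 2.
  have : 0 <= \sum_i s i * h k i - \sum_i s i * p i <= D.
    rewrite -sumrB; apply/andP; split; [apply: sumr_ge0|apply: ler_sum] => i _;
    rewrite -mulrBr /h /hybrid; case: ifP => _; rewrite ?sN ?subrr ?mulr0//.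
  by rewrite ler_norml /m => /andP[? ?]; lra.
have hW k : berE (h k) (fun w => (wsum s w - m) ^+ 2) <= W.
  rewrite berE_wsum_sqr// /W lerD// -[X in X <= _]real_normK ?num_real//.
  rewrite (le_trans (_ : _ <= (D / 2) ^+ 2))//; last by rewrite expr_div_n -natrX.
  by rewrite lerXn2r ?nnegrE ?(le_trans _ (hM k)).
have step (k : 'I_n) :
    `|q k - p k| * (1 - W / l ^+ 2) <= berE (h k.+1) F - berE (h k) F.
  rewrite (berE_diff _ _ k) => [|i ik]; last first.
    by rewrite /h /hybrid ltnS leq_eqVlt -(inj_eq val_inj) in ik *; rewrite (negbTE ik).
  have -> : h k.+1 k - h k k = q k - p k by rewrite /h /hybrid ltnSn ltnn.
  have -> : q k - p k = `|q k - p k| * s k.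
    by rewrite -sN mulrC mulrA -expr2 s1 mul1r.
  rewrite normrM normr_id; have -> : `|s k| = 1 by rewrite /s; case: ifP; rewrite ?normrN normr1.
  rewrite mulr1 -mulrA ler_wpM2l// -berEZ.
  (* The second moment bound [hW] reduces the claim to a pointwise one, where [clip_incr] applies
     with [z] the centred count at [w] itself. *)
  apply: le_trans (_ : berE (h k) (fun w => 1 + (- (l ^- 2)) * (wsum s w - m) ^+ 2) <= _).
    rewrite berED berE1 berEZ lerD2l mulNr lerN2 mulrC ler_wpM2r ?invr_ge0 ?sqr_ge0//.
  apply: berE_le => // w; rewrite mulNr mulrC.
  have wE b := wsum_upd s w k (w k) b; rewrite upd_id// in wE.
  have u := wsum_upd s w k true false; rewrite subr0 mulr1 in u.
  have sk : s k = 1 \/ s k = -1 by rewrite /s; case: ifP; [left|right].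
  have near b : `|(wsum s w - m) - (wsum s (upd w k b) - m)| <= 1.
    rewrite opprB addrA subrK wE normrM (_ : `|s k| = 1) ?mul1r.
      by case: (w k) b => -[]; rewrite /= ?subrr ?subr0 ?sub0r ?normrN ?normr0 ?normr1.
    by case: sk => ->; rewrite ?normrN normr1.
  have [nt nf] := (near true, near false).
  (* For sign -1, switching bit [k] on lowers the count, so the two configurations exchange
     roles. *)
  case: sk u => -> u; rewrite ?mul1r ?mulN1r ?opprB /F.
    have E : wsum s (upd w k true) - m = wsum s (upd w k false) - m + 1 by lra.
    by rewrite E in nt *; apply: clip_incr.
  have E : wsum s (upd w k false) - m = wsum s (upd w k true) - m + 1 by lra.
  by rewrite E in nf *; apply: clip_incr.
have L0 : 0 <= l + 1 by lra.
apply: le_trans (tv_test (berP p) (berP q) F (l + 1) (fun w => clip_norm _ _ L0)).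
have -> : \sum_w berP q w * F w - \sum_w berP p w * F w = berE (h n) F - berE (h 0) F.
  congr (_ - _); apply: eq_bigr => w _; congr (_ * _); apply: eq_bigr => i _;
  by rewrite /h /hybrid ?ltn_ord.
rewrite -(telescope_sumr (fun k => berE (h k) F) (leq0n n)) big_mkord mulr_suml.
exact: ler_sum.
Qed.

End LowerBound.

(** * Comparison of the constants and conclusion *)

Lemma C_BCV_ge1 (R : realType) : 1 <= C_BCV R.
Proof.
rewrite /C_BCV -[leLHS]sqrtr1 ler_wsqrtr//.
by have := sqr_ge0 (eta_BCV R); lra.
Qed.

Theorem theorem5 (R : realType) (n : nat) (p q : 'I_n -> R) :
  (1 <= n)%N ->
  (forall i, 0 <= p i <= 1) -> (forall i, 0 <= q i <= 1) ->
  (48 * C_BCV R)^-1 *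
    tv (binP n ((n%:R : R)^-1 * \sum_(i < n) p i))
       (binP n ((n%:R : R)^-1 * \sum_(i < n) q i))
  <= tv (berP p) (berP q).
Proof.
move=> n0 p01 q01.
have Vp := berVar_le_mean p n0; have Vq := berVar_le_mean q n0.
have mean01 r : (forall i, 0 <= r i <= 1) -> 0 <= (n%:R : R)^-1 * \sum_(i < n) r i <= 1.
  move=> r01; have nR : 0 < n%:R :> R by rewrite ltr0n.
  rewrite mulr_ge0 ?invr_ge0 ?ler0n ?sumr_ge0//= => [|i _]; last by have /andP[] := r01 i.
  rewrite mulrC ler_pdivrMr// mul1r -[X in _ <= X%:R]card_ord -sumr_const ler_sum// => i _.
  by have /andP[] := r01 i.
have a01 := mean01 _ p01; have b01 := mean01 _ q01.
have nd : `|n%:R * (n%:R^-1 * \sum_i p i - n%:R^-1 * \sum_i q i)| <= \sum_i `|q i - p i|.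
  rewrite -mulrBr mulVKf ?pnatr_eq0 -?lt0n// -sumrB (le_trans (ler_norm_sum _ _ _))//.
  by apply: ler_sum => i _; rewrite distrC.
move: Vp Vq a01 b01 nd; move: (_ * \sum_i p i) (_ * \sum_i q i) => a b /= Vp Vq a01 b01 nd.
have T1 := tv_binP_le1 n _ _ a01 b01.
have Tl := tv_binP_lin n _ _ a01 b01.
have Ta := tv_binP_var n _ _ a01 b01.
have Tb := tv_binP_var n _ _ b01 a01.
have T0 := tv_ge0 (binP n a) (binP n b).
rewrite (tvC (binP n b)) in Tb.
set D := \sum_i _ in nd; set T := tv (binP n a) _ in T1 Tl Ta Tb T0 *.
apply: le_trans (_ : 48^-1 * T <= _).
  by rewrite ler_wpM2r// lef_pV2 ?posrE// ?ler_peMr// ?mulr_gt0// ?(lt_le_trans ltr01) ?C_BCV_ge1.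
have [->|Tn] := eqVneq T 0; first by rewrite mulr0 tv_ge0.
have Tgt : 0 < T by rewrite lt0r Tn.
have TD : T <= D by apply: le_trans Tl _; rewrite -[X in X * _]ger0_norm// -normrM.
pose u := D / T.
have uT : D = u * T by rewrite mulfVK.
have u1 : 1 <= u by rewrite ler_pdivlMr// mul1r.
have d2 : (n%:R * (a - b)) ^+ 2 <= D ^+ 2.
  by rewrite -[X in X <= _]real_normK ?num_real// lerXn2r ?nnegrE ?(le_trans _ nd).
have var_le x : T ^+ 2 * x <= 2 * (n%:R * (a - b)) ^+ 2 -> x <= 2 * u ^+ 2.
  move=> H; move: d2; rewrite uT => d2; rewrite -(ler_pM2l (exprn_gt0 2 Tgt)); lra.
(* The half-width [l = 3 * u] is proportional to the bound of order [u] on the standard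
   deviations. *)
have l0 : 0 < 3 * u by lra.
have := tv_berP_ge _ _ _ l0 p01 q01; rewrite -/D.
have Va := var_le _ Ta.
have Vb : n%:R * (b * (1 - b)) <= 2 * u ^+ 2.
  by apply: var_le; have -> : (n%:R * (a - b)) ^+ 2 = (n%:R * (b - a)) ^+ 2 by ring.
set W := _ + D ^+ 2 / 4 => lower.
(* Both variances are at most [2 u^2], and [D <= u] since [T <= 1]; hence
   [W <= (2 + 2 + 1/4) u^2]. *)
have W5 : W / (3 * u) ^+ 2 <= 17 / 36.
  rewrite ler_pdivrMr ?exprn_gt0//.
  have : D ^+ 2 <= u ^+ 2 by rewrite lerXn2r ?nnegrE; nra.
  rewrite /W; nra.
set tvpq := tv _ _ in lower *.
(* Here [19/36 = 1 - 17/36], and [2 (3 u + 1) <= 8 u] because [u >= 1]. *)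
have : D * (19 / 36) <= 8 * u * tvpq.
  have tv0 : 0 <= tvpq by apply: tv_ge0.
  apply: le_trans (le_trans lower _); first by rewrite ler_wpM2l//; nra.
  by rewrite ler_wpM2r//; lra.
(* Cancelling [u] leaves the factor [19/288], which exceeds [1/48 = 6/288]. *)
rewrite uT -mulrA (mulrC 8) -[in X in _ <= X]mulrA ler_pM2l; lra.
Qed.
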